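(* Let $(X_k)_{k\in\mathbb{N}}$ be Banach spaces, let $T_k\in L(X_k,X_{k-1})$ for $k\ge 2$ with $\sup_{k\ge 2}\|T_k\|<\infty$, and let $B_{(T_k)}$ be the associated shift operator on $\ell^p((X_k)_k,\mathbb{N})$ for some $1\le p<\infty$ (resp. on $c_0((X_k)_k,\mathbb{N})$). The following assertions are equivalent: (1) $B_{(T_k)}$ is hypercyclic; (2) $B_{(T_k)}$ is weakly mixing; (3) for every $N\ge 1$ and every family $(U_j)_{1\le j\le N}$, where each $U_j$ is a non-empty open subset of $X_j$, there exists $n\ge 1$ such that for every $1\le j\le N$, $$T_{j,j+n}\,B_{j+n}(0,1)\cap U_j\neq\emptyset .$$
   Context: $\mathbb{N}=\{1,2,3,\dots\}$; Banach spaces are over $\mathbb{K}=\mathbb{R}$ or $\mathbb{C}$, and $L(X,Z)$ denotes the bounded linear operators from $X$ to $Z$. $\ell^p((X_k)_k,\mathbb{N})=\{(x_k)_{k}\in\prod_k X_k:\sum_k\|x_k\|^p<\infty\}$ with norm $(\sum_k\|x_k\|^p)^{1/p}$, and $c_0((X_k)_k,\mathbb{N})=\{(x_k)_k\in\prod_k X_k:\lim_{k\to\infty}\|x_k\|=0\}$ with norm $\sup_k\|x_k\|$. The shift is $B_{(T_k)}(x_k)_{k\in\mathbb{N}}=(T_{k+1}x_{k+1})_{k\in\mathbb{N}}$; it is a bounded operator on these spaces exactly when $\sup_k\|T_k\|<\infty$. For $k<n$, $T_{k,n}=T_{k+1}\circ\cdots\circ T_n\in L(X_n,X_k)$. $B_k(x,r)$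 is the open ball of $X_k$ centered at $x$ with radius $r$. An operator $S$ on a Banach space $Y$ is hypercyclic if some $y\in Y$ has dense orbit $\{S^ny:n\ge 0\}$, and weakly mixing if $S\oplus S$ is hypercyclic on $Y\oplus Y$.
   Formalization: The implication (3) ⇒ (1) is proved assuming every X_k is separable; without this it fails (X_k non-separable Hilbert space, T_k = 2·identity). (1) ⇔ (2) and (1) ⇒ (3) hold without this assumption. *)

(* Defs.v *)
From HB Require Import structures.
From mathcomp Require Import all_boot all_order all_algebra.
From mathcomp Require Import all_classical all_reals all_analysis.
From mathcomp Require Import complex.
Set Implicit Arguments.
Unset Strict Implicit.
Unset Printing Implicit Defensive.
Import Order.TTheory GRing.Theory Num.Theory.
Import numFieldNormedType.Exports.
Local Open Scope classical_set_scope.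
Local Open Scope ring_scope.

Variant scalars := RealScalars | ComplexScalars.

Definition scalar_field (R : realType) (s : scalars) : numFieldType :=
  match s with RealScalars => R | ComplexScalars => R[i] end.

Definition real_part (R : realType) (s : scalars) : scalar_field R s -> R :=
  match s with RealScalars => fun x => x | ComplexScalars => @complex.Re R end.

Definition of_real (R : realType) (s : scalars) : R -> scalar_field R s :=
  match s with
  | RealScalars => fun x => x
  | ComplexScalars => fun x => (x%:C)%C
  end.

Section scalar_field_theory.
Variables (R : realType) (s : scalars).
Local Notation K := (scalar_field R s).
Implicit Types (a b : R) (x y : K).

Lemma of_realK a : real_part (of_real s a) = a.
Proof. by case: s. Qed.

Lemma of_real_inj a b : of_real s a = of_real s b -> a = b.
Proof. by move=> /(congr1 (@real_part R s)); rewrite !of_realK. Qed.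

Lemma of_real0 : of_real s (0 : R) = 0.
Proof. by case: s. Qed.

Lemma of_real1 : of_real s (1 : R) = 1.
Proof. by case: s. Qed.

Lemma of_realD a b : of_real s (a + b) = of_real s a + of_real s b.
Proof. by case: s => //=; exact: rmorphD. Qed.

Lemma of_realM a b : of_real s (a * b) = of_real s a * of_real s b.
Proof. by case: s => //=; exact: rmorphM. Qed.

Lemma le_of_real a b : (of_real s a <= of_real s b) = (a <= b).
Proof. by case: s => //=; exact: lecR. Qed.

Lemma real_partK x : 0 <= x -> of_real s (real_part x) = x.
Proof.
case: s x => //= -[a b]; rewrite lecE /= => /andP[/eqP -> _].
by rewrite complexr0.
Qed.

End scalar_field_theory.

Section real_norm.
Variables (R : realType) (s : scalars).
Local Notation K := (scalar_field R s).
Variable V : normedModType K.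
Implicit Types (x y : V) (a : K).

(* In a [normedModType K] the norm is [K]-valued; [rnorm x] is the same number
   seen in [R] (see [rnormE]). *)
Definition rnorm x : R := real_part `|x|.

Lemma rnormE x : of_real s (rnorm x) = `|x|.
Proof. by rewrite /rnorm real_partK. Qed.

Lemma rnorm_ge0 x : 0 <= rnorm x.
Proof. by rewrite -(le_of_real s) rnormE of_real0. Qed.

Lemma rnorm0 : rnorm 0 = 0.
Proof. by apply: (@of_real_inj _ s); rewrite rnormE of_real0 normr0. Qed.

Lemma rnorm_eq0 x : rnorm x = 0 -> x = 0.
Proof. by move=> x0; apply: normr0_eq0; rewrite -rnormE x0 of_real0. Qed.

Lemma rnormD x y : rnorm (x + y) <= rnorm x + rnorm y.
Proof. by rewrite -(le_of_real s) of_realD !rnormE ler_normD. Qed.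

Lemma rnormZ a x : rnorm (a *: x) = real_part `|a| * rnorm x.
Proof.
by apply: (@of_real_inj _ s); rewrite of_realM !rnormE real_partK// normrZ.
Qed.

End real_norm.

Section operator_norm.
Variables (R : realType) (s : scalars).
Local Notation K := (scalar_field R s).
Variables V W : normedModType K.

Definition opnorm (f : V -> W) : R :=
  sup [set rnorm (f x) | x in [set x | rnorm x <= 1]].

Lemma le_opnorm (f : {linear V -> W}) x :
  continuous f -> rnorm (f x) <= opnorm f * rnorm x.
Proof.
move=> /linear_bounded_continuous /linear_boundedP /pinfty_ex_gt0[M M0 fM].
have {}fM y : rnorm (f y) <= real_part M * rnorm y.
  by rewrite -(le_of_real s) of_realM !rnormE real_partK// ltW.
have M0' : 0 <= real_part M by rewrite -(le_of_real s) of_real0 real_partK// ltW.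
have ub y : rnorm y <= 1 -> rnorm (f y) <= opnorm f.
  move=> y1; apply: ub_le_sup; last by exists y.
  exists (real_part M) => _ [z /= z1 <-].
  by rewrite (le_trans (fM z))// ler_piMr.
have [x0|x0] := eqVneq (rnorm x) 0.
  by rewrite (rnorm_eq0 x0) linear0 !rnorm0 mulr0.
have xgt0 : 0 < rnorm x by rewrite lt_neqAle eq_sym x0 rnorm_ge0.
have na : real_part `|of_real s (rnorm x)^-1| = (rnorm x)^-1.
  rewrite ger0_norm ?of_realK//.
  by rewrite -(of_real0 R s) le_of_real invr_ge0 ltW.
have := ub (of_real s (rnorm x)^-1 *: x).
rewrite linearZ/= !rnormZ na mulVf// lexx => /(_ isT).
by rewrite mulrC ler_pdivrMr.
Qed.

End operator_norm.

(* Indices start at 0: [X k] is the (k+1)-st space, [T k] the operator from the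
   (k+2)-nd space to the (k+1)-st one. *)
Section sequences_of_vectors.
Variables (R : realType) (s : scalars).
Local Notation K := (scalar_field R s).
Variable X : nat -> completeNormedModType K.

Definition seqs : Type := forall k, X k.

HB.instance Definition _ := Choice.on seqs.

Let addA : associative (fun (x y : seqs) k => x k + y k).
Proof. by move=> x y z; apply: functional_extensionality_dep => k; rewrite addrA. Qed.
Let addC : commutative (fun (x y : seqs) k => x k + y k).
Proof. by move=> x y; apply: functional_extensionality_dep => k; rewrite addrC. Qed.
Let add0 : left_id (fun k => 0 : X k) (fun (x y : seqs) k => x k + y k).
Proof. by move=> x; apply: functional_extensionality_dep => k; rewrite add0r. Qed.
Let addN : left_inverse (fun k => 0 : X k) (fun (x : seqs) k => - x k)
  (fun (x y : seqs) k => x k + y k).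
Proof. by move=> x; apply: functional_extensionality_dep => k; rewrite addNr. Qed.

HB.instance Definition _ := GRing.isZmodule.Build seqs addA addC add0 addN.

Let scaleA (a b : K) (x : seqs) :
  (fun k => a *: (b *: x k)) = (fun k => (a * b) *: x k) :> seqs.
Proof. by apply: functional_extensionality_dep => k; rewrite scalerA. Qed.
Let scale1 : left_id 1 (fun (a : K) (x : seqs) => (fun k => a *: x k) : seqs).
Proof. by move=> x; apply: functional_extensionality_dep => k; rewrite scale1r. Qed.
Let scaleDr : right_distributive
  (fun (a : K) (x : seqs) => (fun k => a *: x k) : seqs) +%R.
Proof. by move=> a x y; apply: functional_extensionality_dep => k; rewrite scalerDr. Qed.
Let scaleDl (x : seqs) :
  {morph (fun (a : K) => (fun k => a *: x k) : seqs) : a b / a + b}.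
Proof. by move=> a b; apply: functional_extensionality_dep => k; rewrite scalerDl. Qed.

HB.instance Definition _ :=
  GRing.Zmodule_isLmodule.Build K seqs scaleA scale1 scaleDr scaleDl.

End sequences_of_vectors.

Section seq_shift.
Variables (R : realType) (s : scalars).
Local Notation K := (scalar_field R s).
Variable X : nat -> completeNormedModType K.
Variable T : forall k, {linear X k.+1 -> X k}.

Definition bounded_family : Prop :=
  (forall k, continuous (T k)) /\ has_ubound (range (fun k => opnorm (T k))).

Definition seq_shift (x : seqs X) : seqs X := fun k => T k (x k.+1).

(* [Tcomp j n] is [T j \o T (j + 1) \o ... \o T (j + n - 1)], i.e. the operator
   T_{i,i+n} = T_{i+1} o ... o T_{i+n} with i = j + 1. The index of the domain
   is written [n + j] so that it computes along the recursion. *)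
Fixpoint Tcomp (j n : nat) : X (n + j) -> X j :=
  match n with
  | 0 => fun x => x
  | n'.+1 => fun x => Tcomp (T (n' + j) x)
  end.

Lemma bounded_familyP : bounded_family ->
  exists2 M : R, 0 <= M & forall k x, rnorm (T k x) <= M * rnorm x.
Proof.
move=> [cT [M MT]]; exists (Num.max M 0); first by rewrite le_max lexx orbT.
move=> k x; rewrite (le_trans (le_opnorm _ (cT k)))// ler_wpM2r ?rnorm_ge0//.
by rewrite le_max MT//; exists k.
Qed.

End seq_shift.

Section lp.
Variables (R : realType) (s : scalars).
Local Notation K := (scalar_field R s).
Variable X : nat -> completeNormedModType K.
Variables (p : R) (p1 : 1 <= p).

Definition lp_sum (x : seqs X) : \bar R :=
  (\sum_(k <oo) (rnorm (x k) `^ p)%:E)%E.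

Definition lp_pred : {pred seqs X} := mem [set x | (lp_sum x < +oo)%E].

Definition lp_norm (x : seqs X) : R := fine (lp_sum x) `^ p^-1.

Let p0 : 0 < p. Proof. exact: lt_le_trans p1. Qed.

Lemma lp_sum_ge0 x : (0 <= lp_sum x)%E.
Proof. by apply: nneseries_ge0 => k _ _; rewrite lee_fin powR_ge0. Qed.

Lemma lp_sumE x : x \in lp_pred -> lp_sum x = (lp_norm x `^ p)%:E.
Proof.
rewrite inE/= => xoo; rewrite /lp_norm -powRrM mulVf ?gt_eqF// powRr1.
  by rewrite fineK// ge0_fin_numE ?lp_sum_ge0.
by rewrite fine_ge0 ?lp_sum_ge0.
Qed.

Let LnormE (x : seqs X) :
  Lnorm counting p%:E (fun k => (rnorm (x k))%:E) = (lp_sum x `^ p^-1)%E.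
Proof.
rewrite Lnorm_counting//; congr (_ `^ _)%E.
by apply: eq_eseriesr => k _; rewrite gee0_abs ?lee_fin ?rnorm_ge0.
Qed.

Lemma le_lp_sum (x : seqs X) (f : nat -> R) :
  (forall k, 0 <= f k) -> (forall k, rnorm (x k) <= f k) ->
  (lp_sum x <= \sum_(k <oo) (f k `^ p)%:E)%E.
Proof.
move=> f0 xf; apply: lee_nneseries => k _; rewrite lee_fin ?powR_ge0//.
by apply: ge0_ler_powR; rewrite ?nnegrE ?rnorm_ge0// ltW.
Qed.

Lemma lp_minkowski (x y : seqs X) :
  (lp_sum (x + y)%R `^ p^-1 <= lp_sum x `^ p^-1 + lp_sum y `^ p^-1)%E.
Proof.
have mf (f : nat -> R) : measurable_fun [set: nat] f by [].
have := minkowski_EFin (@counting nat R)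
  (mf (fun k => rnorm (x k))) (mf (fun k => rnorm (y k))) p1.
rewrite /comp -!LnormE; apply: le_trans.
rewrite LnormE Lnorm_counting//.
apply: gt0_ler_poweR.
- by rewrite invr_ge0 ltW.
- by rewrite in_itv/= lp_sum_ge0 leey.
- rewrite in_itv/= leey andbT.
  by apply: nneseries_ge0 => k _ _; rewrite lee_fin powR_ge0.
apply: le_trans (le_lp_sum (f := fun k => rnorm (x k) + rnorm (y k)) _ _) _.
- by move=> k; rewrite addr_ge0 ?rnorm_ge0.
- by move=> k; exact: rnormD.
apply: lee_nneseries => k _ /=; first by rewrite lee_fin powR_ge0.
by rewrite lee_fin ger0_norm// addr_ge0 ?rnorm_ge0.
Qed.

Lemma lp_sumZ (a : K) x :
  (lp_sum (a *: x)%R = (real_part `|a| `^ p)%:E * lp_sum x)%E.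
Proof.
rewrite /lp_sum -nneseriesZl; last by move=> k _; rewrite lee_fin powR_ge0.
by apply: eq_eseriesr => k _; rewrite -EFinM -powRM ?rnorm_ge0 ?rnormZ.
Qed.

Lemma lp_submod_closed : submod_closed lp_pred.
Proof.
split.
  rewrite inE/= /lp_sum eseries0// => k _ _.
  by rewrite rnorm0 powR0 ?gt_eqF.
move=> a x y; rewrite !inE/= => xoo yoo.
have axoo : (lp_sum (a *: x)%R < +oo)%E.
  by rewrite lp_sumZ lte_mul_pinfty ?lee_fin ?powR_ge0.
have pV0 : p^-1 != 0 by rewrite gt_eqF ?invr_gt0.
apply: (@lty_poweRy _ _ p^-1) => //.
by rewrite (le_lt_trans (lp_minkowski _ _))// lte_add_pinfty// poweR_lty.
Qed.

#[local] HB.instance Definition _ :=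
  GRing.isSubmodClosed.Build K (seqs X) lp_pred lp_submod_closed.

(* The proof of [1 <= p] is a parameter of the type because the normed module
   structure depends on it. *)
Record lp_space (p_ge1 : 1 <= p) :=
  Lp { lp_val :> seqs X ; lp_valP : lp_val \in lp_pred }.

Local Notation lp := (lp_space p1).

HB.instance Definition _ := [isSub of lp for @lp_val p1].
HB.instance Definition _ := [Choice of lp by <:].
HB.instance Definition _ := [SubChoice_isSubLmodule of lp by <:].

Lemma lp_valD (x y : lp) : lp_val (x + y) = lp_val x + lp_val y.
Proof. by []. Qed.

Lemma lp_valZ (a : K) (x : lp) : lp_val (a *: x) = a *: lp_val x.
Proof. by []. Qed.

Let lp_normD (x y : lp) : of_real s (lp_norm (x + y : lp)) <=
  of_real s (lp_norm x) + of_real s (lp_norm y).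
Proof.
have E (z : lp) : ((lp_norm z)%:E = lp_sum z `^ p^-1)%E.
  rewrite -poweR_EFin fineK// ge0_fin_numE ?lp_sum_ge0//.
  by have := lp_valP z; rewrite inE.
have := lp_minkowski x y.
by rewrite -lp_valD -!E -EFinD lee_fin -(le_of_real s) of_realD.
Qed.

Let lp_normZ (a : K) (x : lp) :
  of_real s (lp_norm (a *: x : lp)) = `|a| * of_real s (lp_norm x).
Proof.
have a0 : 0 <= real_part `|a| by exact: (rnorm_ge0 (a : K^o)).
have -> : lp_norm (a *: x : lp) = real_part `|a| * lp_norm x.
  rewrite /lp_norm lp_valZ lp_sumZ fineM//; last first.
    by rewrite ge0_fin_numE ?lp_sum_ge0//; have := lp_valP x; rewrite inE.
  rewrite powRM ?powR_ge0 ?fine_ge0 ?lp_sum_ge0//= -powRrM mulfV ?gt_eqF//.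
  by rewrite powRr1.
by rewrite of_realM real_partK.
Qed.

Let lp_norm_eq0 (x : lp) : of_real s (lp_norm x) = 0 -> x = 0.
Proof.
rewrite -(of_real0 R s) => /of_real_inj x0; apply: val_inj => /=.
apply: functional_extensionality_dep => k; apply: rnorm_eq0.
have : ((rnorm (lp_val x k) `^ p)%:E <= 0)%E.
  have <- : (lp_sum x = 0)%E by rewrite lp_sumE ?lp_valP// x0 powR0 ?gt_eqF.
  apply: le_trans (nneseries_lim_ge k.+1 _); last first.
    by move=> n _ _; rewrite lee_fin powR_ge0.
  by rewrite big_nat_recr//= leeDr// sume_ge0// => n _; rewrite lee_fin powR_ge0.
rewrite lee_fin => xp0.
have : rnorm (lp_val x k) `^ p == 0 by rewrite eq_le xp0 powR_ge0.
by rewrite powR_eq0 => /andP[/eqP].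
Qed.

HB.instance Definition _ :=
  Lmodule_isNormed.Build K lp lp_normD lp_normZ lp_norm_eq0.

Variable T : forall k, {linear X k.+1 -> X k}.

Lemma shift_lp (x : seqs X) :
  bounded_family T -> x \in lp_pred -> seq_shift T x \in lp_pred.
Proof.
move=> /bounded_familyP[M M0 TM]; rewrite !inE /= => xoo.
apply: le_lt_trans (le_lp_sum (f := fun k => M * rnorm (x k.+1)) _ _) _.
- by move=> k; rewrite mulr_ge0 ?rnorm_ge0.
- by move=> k; exact: TM.
rewrite (eq_eseriesr (g := fun k => (M `^ p)%:E * (rnorm (x k.+1) `^ p)%:E)%E);
  last by move=> k _; rewrite -EFinM powRM ?rnorm_ge0.
rewrite nneseriesZl; last by move=> k _; rewrite lee_fin powR_ge0.
rewrite lte_mul_pinfty ?lee_fin ?powR_ge0//; apply: le_lt_trans xoo.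
rewrite /lp_sum [leRHS]nneseries_recl//; last by move=> k _; rewrite lee_fin powR_ge0.
have -> : (\sum_(1 <= k <oo) (rnorm (x k) `^ p)%:E =
    \sum_(k <oo) (rnorm (x k.+1) `^ p)%:E)%E.
  rewrite -(@nneseries_addn _ (fun k => (rnorm (x k) `^ p)%:E) 1).
    by apply: eq_eseriesr => k _; rewrite addn1.
  by move=> k; rewrite lee_fin powR_ge0.
by rewrite leeDr// lee_fin powR_ge0.
Qed.

Definition lp_shift (hT : bounded_family T) (x : lp) : lp :=
  Lp p1 (shift_lp hT (lp_valP x)).

End lp.
Arguments lp_shift {R s X p} p1 {T} hT x.

Section c0.
Variables (R : realType) (s : scalars).
Local Notation K := (scalar_field R s).
Variable X : nat -> completeNormedModType K.

Definition c0_pred : {pred seqs X} :=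
  mem [set x | (fun k => rnorm (x k)) @ \oo --> (0 : R)].

Definition c0_norm (x : seqs X) : R := sup (range (fun k => rnorm (x k))).

Lemma le_c0_norm x k : x \in c0_pred -> rnorm (x k) <= c0_norm x.
Proof.
rewrite inE/= => x0; apply: ub_le_sup; last by exists k.
have /cvg_seq_bounded : cvgn (fun k => rnorm (x k)) by apply/cvg_ex; exists 0.
move=> /pinfty_ex_gt0[M _ xM]; exists M => _ [j _ <-].
by rewrite (le_trans _ (xM j I))// ler_norm.
Qed.

Lemma c0_norm_le x (M : R) : (forall k, rnorm (x k) <= M) -> c0_norm x <= M.
Proof.
move=> xM; apply: ge_sup; first by exists (rnorm (x 0%N)); exists 0%N.
by move=> _ [k _ <-].
Qed.

Lemma c0_submod_closed : submod_closed c0_pred.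
Proof.
split.
  rewrite inE/= (_ : (fun _ => _) = cst 0); first exact: cvg_cst.
  by apply/funext => k; rewrite rnorm0.
move=> a x y; rewrite !inE/= => x0 y0.
apply: (@squeeze_cvgr _ _ _ _ (cst 0)
  (fun k => real_part `|a| * rnorm (x k) + rnorm (y k))).
- apply: nearW => k; rewrite rnorm_ge0/= (le_trans (rnormD _ _))//.
  by rewrite rnormZ.
- exact: cvg_cst.
- rewrite -[X in _ --> X]addr0 -[X in _ --> X + _](mulr0 (real_part `|a|)).
  by apply: cvgD => //; apply: cvgMr.
Qed.

HB.instance Definition _ :=
  GRing.isSubmodClosed.Build K (seqs X) c0_pred c0_submod_closed.

Record c0_space := C0 { c0_val :> seqs X ; c0_valP : c0_val \in c0_pred }.

Local Notation c0 := c0_space.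

HB.instance Definition _ := [isSub for c0_val].
HB.instance Definition _ := [Choice of c0 by <:].
HB.instance Definition _ := [SubChoice_isSubLmodule of c0 by <:].

Lemma c0_valD (x y : c0) : c0_val (x + y) = c0_val x + c0_val y.
Proof. by []. Qed.

Lemma c0_valZ (a : K) (x : c0) : c0_val (a *: x) = a *: c0_val x.
Proof. by []. Qed.

Let c0_normD (x y : c0) : of_real s (c0_norm (x + y : c0)) <=
  of_real s (c0_norm x) + of_real s (c0_norm y).
Proof.
rewrite -of_realD le_of_real; apply: c0_norm_le => k.
by rewrite (le_trans (rnormD _ _))// lerD// le_c0_norm// c0_valP.
Qed.

Let c0_normZ (a : K) (x : c0) :
  of_real s (c0_norm (a *: x : c0)) = `|a| * of_real s (c0_norm x).
Proof.
have ge0 (b : K) : 0 <= real_part `|b| by exact: (rnorm_ge0 (b : K^o)).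
have le (b : K) (y : c0) : c0_norm (b *: y : c0) <= real_part `|b| * c0_norm y.
  by apply: c0_norm_le => k; rewrite rnormZ ler_wpM2l// le_c0_norm// c0_valP.
rewrite -[in RHS](real_partK (x := `|a|))// -of_realM; congr of_real.
apply/eqP; rewrite eq_le le/=.
have [->|a0] := eqVneq a 0.
  rewrite normr0 -(of_real0 R s) of_realK mul0r.
  apply: le_trans (le_c0_norm 0%N (c0_valP (of_real s 0 *: x))).
  exact: rnorm_ge0.
have := le a^-1 (a *: x); rewrite scalerA mulVf// scale1r.
move=> /(ler_wpM2l (ge0 a)); rewrite mulrA.
suff -> : real_part `|a| * real_part `|a^-1| = 1 :> R by rewrite mul1r.
apply: (@of_real_inj _ s).
by rewrite of_realM !real_partK// -normrM mulfV// normr1 of_real1.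
Qed.

Let c0_norm_eq0 (x : c0) : of_real s (c0_norm x) = 0 -> x = 0.
Proof.
rewrite -(of_real0 R s) => /of_real_inj x0; apply: val_inj => /=.
apply: functional_extensionality_dep => k; apply: rnorm_eq0.
by apply/eqP; rewrite eq_le rnorm_ge0 andbT -x0 le_c0_norm// c0_valP.
Qed.

HB.instance Definition _ :=
  Lmodule_isNormed.Build K c0 c0_normD c0_normZ c0_norm_eq0.

Variable T : forall k, {linear X k.+1 -> X k}.

Lemma shift_c0 (x : seqs X) :
  bounded_family T -> x \in c0_pred -> seq_shift T x \in c0_pred.
Proof.
move=> /bounded_familyP[M M0 TM]; rewrite !inE /= => x0.
apply: (@squeeze_cvgr _ _ _ _ (cst 0) (fun k => M * rnorm (x k.+1))).
- by apply: nearW => k; rewrite rnorm_ge0/= TM.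
- exact: cvg_cst.
- rewrite -[X in _ --> X](mulr0 M); apply: cvgMr.
  by move: x0; rewrite -cvg_shiftS.
Qed.

Definition c0_shift (hT : bounded_family T) (x : c0) : c0 :=
  C0 (shift_c0 hT (c0_valP x)).

End c0.
Arguments c0_shift {R s X T} hT x.

Definition hypercyclic (Y : topologicalType) (S : Y -> Y) : Prop :=
  exists y, dense (range (fun n => iter n S y)).

Definition weakly_mixing (Y : topologicalType) (S : Y -> Y) : Prop :=
  hypercyclic (fun z : Y * Y => (S z.1, S z.2)).

(* Hypercyclicity forces the space to be separable, whereas [ball_images_meet]
   below also holds, e.g., for [T k = 2 id] on a non-separable Banach space. *)
Definition separable_space (Y : topologicalType) : Prop :=
  exists2 D : set Y, countable D & dense D.

Definition ball_images_meet (R : realType) (s : scalars)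
    (X : nat -> completeNormedModType (scalar_field R s))
    (T : forall k, {linear X k.+1 -> X k}) : Prop :=
  forall (N : nat) (U : forall j : 'I_N, set (X j)),
    (1 <= N)%N -> (forall j, open (U j) /\ U j !=set0) ->
    exists2 n : nat, (1 <= n)%N & forall j : 'I_N,
      (Tcomp T (j := j) (n := n) @` ball (0 : X (n + j)%N) 1) `&` U j !=set0.

(* Main.v *)
(* A sequence-space version of the hypercyclicity criterion, carried out for the
   l^1 norm, which dominates the norms of all l^p and of c_0.

   Assume (3). By linearity (3) says: every finitely supported v is approximated
   by some S^n x with x small, where S is the shift. Applying this to x in turn
   shows that n may be taken arbitrarily large. It also gives the same n for two
   targets v and w: choose z small with S^m z near w and m beyond the support of
   v; if x is small and S^n x is near v + z, then S^n x is near v and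
   S^n (S^m x) = S^m (S^n x) is near S^m z, hence near w. Enumerating a countable
   dense set of pairs of targets, with infinite repetition, and summing the
   resulting finitely supported vectors, chosen further and further out and
   smaller and smaller, produces a pair whose joint orbit is dense; coordinatewise
   these sums are finite, so no completeness is used.

   Conversely the coordinates of a hypercyclic vector y tend to 0, its orbit is
   dense even after dropping finitely many terms, and the j-th coordinate of S^n y
   is T_{j,j+n} y_{j+n}. Hypercyclicity also makes every X_k separable. *)
Require Import Defs.
From HB Require Import structures.
From mathcomp Require Import all_boot all_order all_algebra.
From mathcomp Require Import all_classical all_reals all_analysis.
From mathcomp Require Import lra zify.
Import Order.TTheory GRing.Theory Num.Theory.
Import numFieldNormedType.Exports.
Local Open Scope classical_set_scope.
Local Open Scope ring_scope.
Set Implicit Arguments.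
Unset Strict Implicit.
Unset Printing Implicit Defensive.

(** * Real-valued norms and the l^1 norm *)

Section real_norm_topology.
Variables (R : realType) (s : scalars).
Local Notation K := (scalar_field R s).
Variable V : normedModType K.
Implicit Types (x y : V) (a : K) (A : set V).

Lemma lt_of_real (a b : R) : (of_real s a < of_real s b) = (a < b).
Proof. by rewrite !lt_neqAle le_of_real (inj_eq (@of_real_inj R s)). Qed.

Lemma of_real_gt0 (a : R) : (0 < of_real s a) = (0 < a).
Proof. by rewrite -lt_of_real of_real0. Qed.

Lemma real_part_gt0 a : 0 < a -> 0 < real_part a.
Proof. by move=> a0; rewrite -of_real_gt0 real_partK// ltW. Qed.

Lemma real_part_norm_of_real (a : R) :
  0 <= a -> real_part `|of_real s a| = a.
Proof. by move=> a0; rewrite ger0_norm ?of_realK// -(of_real0 R s) le_of_real. Qed.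

Lemma rnormN x : rnorm (- x) = rnorm x.
Proof. by rewrite /rnorm normrN. Qed.

Lemma rnorm_distC x y : rnorm (x - y) = rnorm (y - x).
Proof. by rewrite -rnormN opprB. Qed.

Lemma ball_rnorm x (e : R) y :
  ball x (of_real s e) y <-> rnorm (x - y) < e.
Proof. by rewrite -ball_normE/= -rnormE lt_of_real. Qed.

Lemma nbhs_rnormP x A :
  nbhs x A <-> exists2 e : R, 0 < e & forall y, rnorm (x - y) < e -> A y.
Proof.
split=> [/nbhs_ballP[e /= e0 eA]|[e e0 eA]].
  exists (real_part e); first exact: real_part_gt0.
  by move=> y xy; apply: eA; rewrite -(real_partK (ltW e0)); apply/ball_rnorm.
apply/nbhs_ballP; exists (of_real s e); first by rewrite /= of_real_gt0.
by move=> y /ball_rnorm; exact: eA.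
Qed.

Lemma open_rnormP A x : open A -> A x ->
  exists2 e : R, 0 < e & forall y, rnorm (x - y) < e -> A y.
Proof. by move=> oA Ax; apply/nbhs_rnormP; exact: open_nbhs_nbhs. Qed.

End real_norm_topology.

Section shift_iterates.
Variables (R : realType) (s : scalars).
Local Notation K := (scalar_field R s).
Variable X : nat -> completeNormedModType K.
Implicit Types (x y : seqs X).

Lemma seqs_addE x y k : (x + y) k = x k + y k.
Proof. by []. Qed.

Lemma seqs_subE x y k : (x - y) k = x k - y k.
Proof. by []. Qed.

Lemma seqs_sumE (I : Type) (r : seq I) (F : I -> seqs X) k :
  (\sum_(i <- r) F i) k = \sum_(i <- r) F i k.
Proof. by elim/big_rec2: _ => // i _ z _ <-. Qed.

Definition vanish_from x (N : nat) : Prop := forall k, (N <= k)%N -> x k = 0.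

Lemma vanish_fromW x (N N' : nat) :
  (N <= N')%N -> vanish_from x N -> vanish_from x N'.
Proof. by move=> NN xN k /(leq_trans NN); exact: xN. Qed.

Lemma vanish_fromD x y N :
  vanish_from x N -> vanish_from y N -> vanish_from (x + y) N.
Proof. by move=> xN yN k Nk; rewrite seqs_addE xN// yN// addr0. Qed.

Definition l1_le x (c : R) : Prop :=
  forall n, \sum_(0 <= k < n) rnorm (x k) <= c.

Lemma l1_le0 : l1_le 0 0.
Proof. by move=> n; rewrite big1// => k _; rewrite rnorm0. Qed.

Lemma l1_leW x (c d : R) : c <= d -> l1_le x c -> l1_le x d.
Proof. by move=> cd xc n; exact: le_trans cd. Qed.

Lemma l1_leD x y (c d : R) : l1_le x c -> l1_le y d -> l1_le (x + y) (c + d).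
Proof.
move=> xc yd n; apply: le_trans (lerD (xc n) (yd n)).
by rewrite -big_split ler_sum// => k _; exact: rnormD.
Qed.

Lemma l1_leN x (c : R) : l1_le x c -> l1_le (- x) c.
Proof.
move=> xc n; apply: le_trans (xc n).
by rewrite ler_sum// => k _; rewrite -[(- x) k]/(- x k) rnormN.
Qed.

Lemma l1_le_mono x y (c : R) :
  (forall k, rnorm (x k) <= rnorm (y k)) -> l1_le y c -> l1_le x c.
Proof. by move=> xy yc n; apply: le_trans (yc n); rewrite ler_sum. Qed.

Lemma l1_le_rnorm x (c : R) k : l1_le x c -> rnorm (x k) <= c.
Proof.
move=> /(_ k.+1); apply: le_trans; rewrite big_nat_recr//= lerDr.
by rewrite sumr_ge0// => i _; exact: rnorm_ge0.
Qed.

Lemma l1_le_vanish x N :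
  vanish_from x N -> l1_le x (\sum_(0 <= k < N) rnorm (x k)).
Proof.
move=> xN m; have r0 k : 0 <= rnorm (x k) by exact: rnorm_ge0.
have [mN|/ltnW Nm] := leqP m N.
  by rewrite (big_cat_nat (leq0n m) mN)/= lerDl sumr_ge0.
rewrite (big_cat_nat (leq0n N) Nm)/= gerDl [leLHS]big_nat big1//.
by move=> k /andP[Nk _]; rewrite xN// rnorm0.
Qed.

Lemma l1_le_support x n N (e : R) : 0 <= e ->
  (forall k, (k < n)%N -> x k = 0) -> vanish_from x (n + N) ->
  (forall k, rnorm (x k) <= e) -> l1_le x (e *+ N).
Proof.
move=> e0 xn xN xe; apply: l1_leW (l1_le_vanish xN).
rewrite (big_cat_nat (leq0n n) (leq_addr N n))/= big_nat big1 ?add0r; last first.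
  by move=> k kn; rewrite xn// rnorm0.
by apply: le_trans (ler_sum _ (fun k _ => xe k)) _; rewrite sumr_const_nat addKn.
Qed.

Variable T : forall k, {linear X k.+1 -> X k}.
Local Notation S := (seq_shift T).

Lemma iter_seq_shiftE n x j : iter n S x j = Tcomp T (x (n + j)%N).
Proof. by elim: n x => // n IHn x; rewrite iterSr IHn. Qed.

Lemma iter_seq_shiftD n x y : iter n S (x + y) = iter n S x + iter n S y.
Proof.
elim: n => // n IHn; rewrite !iterS IHn.
by apply: functional_extensionality_dep => k; rewrite /seq_shift seqs_addE linearD.
Qed.

Lemma iter_seq_shiftB n x y : iter n S (x - y) = iter n S x - iter n S y.
Proof.
by apply/eqP; rewrite -subr_eq opprK; apply/eqP; rewrite -iter_seq_shiftD subrK.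
Qed.

Lemma iter_seq_shift_vanish n x N :
  vanish_from x N -> vanish_from (iter n S x) (N - n).
Proof.
elim: n x N => [|n IHn] x N xN; first by rewrite subn0.
rewrite iterS => k; rewrite leq_subLR => Nk.
rewrite /seq_shift (IHn _ _ xN) ?linear0// leq_subLR; lia.
Qed.

Lemma iter_seq_shift_eq0 n x N :
  (N <= n)%N -> vanish_from x N -> iter n S x = 0.
Proof.
move=> Nn /(@iter_seq_shift_vanish n).
rewrite (eqP (_ : (N - n == 0)%N))// => x0.
by apply: functional_extensionality_dep => k; exact: x0.
Qed.

Lemma eq_iter_seq_shift n x y : (forall k, (n <= k)%N -> x k = y k) ->
  iter n S x = iter n S y.
Proof.
move=> xy; apply: functional_extensionality_dep => k.
by rewrite !iter_seq_shiftE xy// leq_addr.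
Qed.

Lemma l1_le_iter_shift (M : R) : 0 <= M ->
  (forall k (z : X k.+1), rnorm (T k z) <= M * rnorm z) ->
  forall n x c, l1_le x c -> l1_le (iter n S x) (M ^+ n * c).
Proof.
move=> M0 TM n x c xc; elim: n => [|n IHn]; first by rewrite mul1r.
move=> m; rewrite exprS -mulrA.
apply: le_trans (_ : M * \sum_(0 <= k < m) rnorm (iter n S x k.+1) <= _).
  by rewrite mulr_sumr ler_sum// => k _; exact: TM.
rewrite ler_wpM2l//; apply: le_trans (IHn m.+1).
by rewrite big_nat_recl//= lerDr rnorm_ge0.
Qed.

End shift_iterates.

(** * Approximation by images of small vectors *)

Section approximation.
Variables (R : realType) (s : scalars).
Local Notation K := (scalar_field R s).
Variable X : nat -> completeNormedModType K.
Variable T : forall k, {linear X k.+1 -> X k}.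
Local Notation S := (seq_shift T).
Implicit Types (v w x y : seqs X).

Lemma Tcomp_linear j n a (x : X (n + j)%N) : Tcomp T (a *: x) = a *: Tcomp T x.
Proof. by elim: n x => //= n IHn x; rewrite linearZ IHn. Qed.

Lemma seqs_choice (P : forall k, X k -> Prop) :
  (forall k, exists z, P k z) -> exists x : seqs X, forall k, P k (x k).
Proof. by move=> /(_ _)/cid Pz; exists (fun k => sval (Pz k)) => k; case: (Pz k). Qed.

Lemma shift_approx (N : nat) v (e : R) : ball_images_meet T ->
  vanish_from v N -> 0 < e ->
  exists n b x, [/\ (0 < n)%N, vanish_from x b, l1_le x e
    & l1_le (iter n S x - v) e].
Proof.
move=> meet vN e0; pose d := e / N.+1%:R.
have d0 : 0 < d by rewrite divr_gt0.
have dN : d *+ N.+1 = e by rewrite -[LHS]mulr_natr divfK.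
pose a : K := of_real s d.
have a0 : a != 0 by rewrite gt_eqF// of_real_gt0.
have rZ (V : normedModType K) (z : V) : rnorm (a *: z) = d * rnorm z.
  by rewrite rnormZ real_part_norm_of_real// ltW.
pose U (j : 'I_N.+1) : set (X j) := ball (a^-1 *: v j) 1.
have [||n n0 nU] := meet N.+1 U; first by [].
  move=> j; split; first exact: ball_open.
  by exists (a^-1 *: v j); exact: ballxx.
have one : (1 : K) = of_real s 1 by rewrite of_real1.
pose P k (z : X k) := [/\ rnorm z <= d, ~~ (n <= k < n + N.+1)%N -> z = 0 &
  forall j (e : k = (n + j)%N), (j < N.+1)%N ->
    rnorm (Tcomp T (ecast i (X i) e z) - v j) <= d].
have [k|x Px] := @seqs_choice P.
  have [nk|nk] := boolP (n <= k <= n + N)%N; last first.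
    exists 0; split => //; first by rewrite rnorm0 ltW.
    by move=> j ek jN; exfalso; lia.
  have [j ->{k nk} jN] : exists2 j, k = (n + j)%N & (j < N.+1)%N.
    by exists (k - n)%N; lia.
  have [z [[u /= u1 <-] uU]] := nU (Ordinal jN).
  exists (a *: u); split.
  - rewrite rZ -[leRHS]mulr1 ler_wpM2l ?ltW// -(rnormN u) -sub0r.
    by apply/ball_rnorm; rewrite -one.
  - lia.
  move=> i ei; have ij : i = j by lia.
  rewrite {}ij in ei *; rewrite (eq_irrelevance ei erefl) => _.
  have -> : v j = a *: (a^-1 *: v j) by rewrite scalerA divff// scale1r.
  rewrite Tcomp_linear -scalerBr rZ -[leRHS]mulr1 ler_wpM2l ?ltW// rnorm_distC.
  by apply/ball_rnorm; rewrite -one.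
have x0 k : ~~ (n <= k < n + N.+1)%N -> x k = 0 by have [] := Px k.
have x_vanish : vanish_from x (n + N.+1) by move=> k Nk; apply: x0; lia.
have Sxv : vanish_from (iter n S x - v) N.+1.
  move=> k Nk; rewrite seqs_subE vN ?subr0 1?ltnW//.
  by have := iter_seq_shift_vanish T (n := n) x_vanish; rewrite addKn; apply.
exists n, (n + N.+1)%N, x; split => //; rewrite -dN.
  apply: (@l1_le_support _ _ _ _ n) => //; first exact: ltW.
    by move=> k kN; apply: x0; lia.
  by move=> k; have [] := Px k.
apply: (@l1_le_support _ _ _ _ 0%N) => //; first exact: ltW.
move=> k.
have [kN|Nk] := ltnP k N.+1; last by rewrite Sxv// rnorm0 ltW.
by rewrite seqs_subE iter_seq_shiftE; have [_ _ /(_ k erefl kN)] := Px (n + k)%N.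
Qed.

Hypothesis meet : ball_images_meet T.
Variable M : R.
Hypothesis M1 : 1 <= M.
Hypothesis TM : forall k (z : X k.+1), rnorm (T k z) <= M * rnorm z.

Let M0 n : 0 < M ^+ n.
Proof. by rewrite exprn_gt0// (lt_le_trans _ M1). Qed.

Let l1S n x c : l1_le x c -> l1_le (iter n S x) (M ^+ n * c).
Proof. by apply: l1_le_iter_shift => //; rewrite (le_trans _ M1). Qed.

Lemma shift_approx_late (L N : nat) v (e : R) : vanish_from v N -> 0 < e ->
  exists n b x, [/\ (L <= n)%N, vanish_from x b, l1_le x e
    & l1_le (iter n S x - v) e].
Proof.
move=> vN; elim: L e => [|L IHL] e e0.
  have [n [b [x [_ xb xe Sxe]]]] := shift_approx meet vN e0.
  by exists n, b, x.
have e20 : 0 < e / 2 by rewrite divr_gt0.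
have [n [b [x [Ln xb xe Sxe]]]] := IHL _ e20.
pose d := Num.min e ((M ^+ n)^-1 * (e / 2)).
have d0 : 0 < d by rewrite lt_min e0 mulr_gt0// invr_gt0.
have [m [c [y [m0 yc ye Sye]]]] := shift_approx meet xb d0.
exists (n + m)%N, c, y; split => //; first by lia.
  by apply: l1_leW ye; rewrite ge_min lexx.
rewrite iterD.
have -> : iter n S (iter m S y) - v = iter n S (iter m S y - x) + (iter n S x - v).
  by rewrite iter_seq_shiftB addrA subrK.
rewrite [e]splitr; apply: l1_leD => //; apply: l1_leW (l1S n Sye).
by rewrite -ler_pdivlMl// ge_min lexx orbT.
Qed.

Lemma shift_approx_pair (L N : nat) v w (e : R) :
  vanish_from v N -> vanish_from w N -> 0 < e ->
  exists n b x y, [/\ (L <= n)%N,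
    (forall k, (k < n)%N -> x k = 0 /\ y k = 0),
    vanish_from x b /\ vanish_from y b, l1_le x e /\ l1_le y e
    & l1_le (iter n S x - v) e /\ l1_le (iter n S y - w) e].
Proof.
move=> vN wN e0.
have e20 : 0 < e / 2 by rewrite divr_gt0.
have [m [b [z [Nm zb ze Sze]]]] := shift_approx_late N wN e20.
pose d := (M ^+ m)^-1 * (e / 2).
have d0 : 0 < d by rewrite mulr_gt0// invr_gt0.
have Md : M ^+ m * d = e / 2 by rewrite mulVKf ?gt_eqF.
have dM : d <= e / 2.
  by rewrite -Md ler_peMl ?exprn_ege1// ltW.
have vzb : vanish_from (v + z) (maxn N b).
  by apply: vanish_fromD; [apply: vanish_fromW vN|apply: vanish_fromW zb];
    rewrite leq_max leqnn ?orbT.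
have [n [c [x [Ln xc xd Sxd]]]] := shift_approx_late L vzb d0.
pose cut u : seqs X := fun k => if (k < n)%N then 0 else u k.
have Scut u : iter n S (cut u) = iter n S u.
  by apply: eq_iter_seq_shift => k nk; rewrite /cut ltnNge nk.
have cutb u a : vanish_from u a -> vanish_from (cut u) a.
  by move=> ua k ak; rewrite /cut ua// if_same.
have cut_l1 u a : l1_le u a -> l1_le (cut u) a.
  by apply: l1_le_mono => k; rewrite /cut; case: ifP; rewrite // rnorm0 rnorm_ge0.
have de : d <= e by apply: le_trans dM _; lra.
exists n, c, (cut x), (cut (iter m S x)); split => //.
- by move=> k kn; rewrite /cut kn.
- split; apply: cutb => //.
  by apply: vanish_fromW (iter_seq_shift_vanish T (n := m) xc); exact: leq_subr.
- split; apply: cut_l1; first exact: l1_leW xd.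
  by apply: l1_leW (l1S m xd); rewrite Md; lra.
rewrite !Scut; split.
  have -> : iter n S x - v = (iter n S x - (v + z)) + z by rewrite opprD addrA subrK.
  by rewrite [e]splitr; apply: l1_leD => //; exact: l1_leW Sxd.
have -> : iter n S (iter m S x) - w =
    iter m S (iter n S x - (v + z)) + (iter m S z - w).
  rewrite iter_seq_shiftB iter_seq_shiftD -!iterD addnC.
  by rewrite [iter m S v](iter_seq_shift_eq0 T Nm vN) add0r addrA subrK.
by rewrite [e]splitr; apply: l1_leD => //; rewrite -Md; exact: l1S.
Qed.

End approximation.

(** * A vector assembled from blocks *)

Section series.
Variables (R : realType) (s : scalars).
Local Notation K := (scalar_field R s).
Variable X : nat -> completeNormedModType K.
Variable T : forall k, {linear X k.+1 -> X k}.
Local Notation S := (seq_shift T).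
Implicit Types (v w x y : seqs X).
Variable M : R.
Hypothesis M1 : 1 <= M.
Hypothesis TM : forall k (z : X k.+1), rnorm (T k z) <= M * rnorm z.

Local Notation h l := ((2^-1 : R) ^+ l).

Let hS l : h l = h l.+1 + h l.+1.
Proof. by rewrite exprSr -splitr. Qed.

Variables (b n : nat -> nat) (x v : nat -> seqs X).
Hypothesis bn : forall l, (b l <= n l < b l.+1)%N.
Hypothesis x_n : forall l k, (k < n l)%N -> x l k = 0.
Hypothesis x_b : forall l, vanish_from (x l) (b l.+1).
Hypothesis x_le : forall l, l1_le (x l) ((M ^+ b l)^-1 * h l.+1).
Hypothesis x_v : forall l, l1_le (iter (n l) S (x l) - v l) (h l.+1).

Definition diag_sum : seqs X := fun k => \sum_(0 <= l < k.+1) x l k.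

Let part L : seqs X := \sum_(0 <= l < L) x l.

Let b_mono : {homo b : k l / (k <= l)%N}.
Proof. by apply: homo_leq => [//|? ? ?|k]; [exact: leq_trans|have := bn k; lia]. Qed.

Let leq_b l : (l <= b l)%N.
Proof. by elim: l => // l IHl; have := bn l; lia. Qed.

Let diag_sumE L k : (k < L)%N -> diag_sum k = part L k.
Proof.
move=> kL; rewrite /diag_sum /part seqs_sumE (big_cat_nat (leq0n k.+1) kL)/=.
rewrite [X in _ + X]big_nat [X in _ + X]big1 ?addr0// => l /andP[kl _].
by rewrite x_n//; have := bn l; have := leq_b l; lia.
Qed.

Let partS L : part L.+1 = part L + x L.
Proof. by rewrite /part big_nat_recr. Qed.

Let part_vanish L : vanish_from (part L) (b L).
Proof.
elim: L => [|L IHL]; first by move=> k _; rewrite /part big_nil.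
rewrite partS; apply: vanish_fromD => //; apply: vanish_fromW IHL.
exact: b_mono.
Qed.

Let part_le L : l1_le (part L) (1 - h L).
Proof.
elim: L => [|L IHL]; first by rewrite /part big_nil subrr; exact: l1_le0.
rewrite partS (_ : 1 - h L.+1 = 1 - h L + h L.+1); last by rewrite (hS L); lra.
apply: l1_leD => //; apply: l1_leW (x_le L).
by rewrite ler_piMl ?exprn_ge0// invf_le1 ?exprn_ege1// exprn_gt0// (lt_le_trans _ M1).
Qed.

Lemma l1_le_diag_sum : l1_le diag_sum 1.
Proof.
move=> m; rewrite (eq_big_nat _ _ (F2 := fun k => rnorm (part m k))); last first.
  by move=> k /andP[_ km]; rewrite (diag_sumE km).
by apply: le_trans (part_le m m) _; rewrite gerBl exprn_ge0.
Qed.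

Let orbit_part k L : (k < L)%N ->
  l1_le (iter (n k) S (part L) - v k) (h k - h L).
Proof.
elim: L => // L IHL; rewrite ltnS leq_eqVlt => /predU1P[<-{L IHL}|kL].
  rewrite partS iter_seq_shiftD (iter_seq_shift_eq0 T _ (@part_vanish k)); last first.
    by have := bn k; lia.
  by rewrite add0r {1}(hS k) addrK.
rewrite partS iter_seq_shiftD addrAC.
rewrite (_ : h k - h L.+1 = h k - h L + h L.+1); last by rewrite (hS L); lra.
apply: l1_leD; first exact: IHL.
have M0 m : 0 < M ^+ m by rewrite exprn_gt0// (lt_le_trans _ M1).
apply: l1_leW (l1_le_iter_shift (le_trans ler01 M1) TM (n k) (x_le L)).
rewrite mulrA ler_piMl ?exprn_ge0// ler_pdivrMr// mul1r ler_weXn2l//.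
by have := bn k; have := b_mono kL; lia.
Qed.

Lemma orbit_diag_sum k : l1_le (iter (n k) S diag_sum - v k) (h k).
Proof.
move=> m; pose L := (n k + m + k).+1.
rewrite (eq_big_nat _ _
  (F2 := fun i => rnorm ((iter (n k) S (part L) - v k) i))); last first.
  move=> i /andP[_ im]; rewrite !seqs_subE !iter_seq_shiftE (@diag_sumE L)//.
  by rewrite /L; lia.
have kL : (k < L)%N by rewrite /L; lia.
by apply: le_trans (@orbit_part k L kL m) _; rewrite gerBl exprn_ge0.
Qed.

End series.

(** * A jointly dense orbit *)

Lemma separable_dense_sequence (R : realType) (s : scalars)
    (V : normedModType (scalar_field R s)) : separable_space V ->
  exists d : nat -> V, forall z (e : R), 0 < e -> exists i, rnorm (z - d i) < e.
Proof.
move=> [D /countable_injP[f f_inj] dD].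
exists (fun i => xget 0 [set z | D z /\ f z = i]) => z e e0.
have [] := dD (ball z (of_real s e)).
- by exists z; apply/ball_rnorm; rewrite subrr rnorm0.
- exact: ball_open.
move=> y [/ball_rnorm zy Dy]; exists (f y); rewrite (@xget_unique _ _ _ y)//.
by move=> y' [Dy' /f_inj]; apply; rewrite inE.
Qed.

Section joint_orbit.
Variables (R : realType) (s : scalars).
Local Notation K := (scalar_field R s).
Variable X : nat -> completeNormedModType K.
Variable T : forall k, {linear X k.+1 -> X k}.
Local Notation S := (seq_shift T).
Implicit Types (v w x y : seqs X).
Hypothesis X_sep : forall k, separable_space (X k).

Lemma finite_dense_family : exists vec : seq nat -> seqs X,
  (forall c, vanish_from (vec c) (size c)) /\
  forall N v (e : R), vanish_from v N -> 0 < e ->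
    exists c, l1_le (vec c - v) e.
Proof.
have /(_ _)/cid d k := separable_dense_sequence (X_sep k).
exists (fun c k => if (k < size c)%N then sval (d k) (nth 0%N c k) else 0).
split=> [c k|N v e vN e0]; first by rewrite ltnNge => ->.
pose r := e / N.+1%:R.
have r0 : 0 < r by rewrite divr_gt0.
have /choice[i vi] k : exists i, rnorm (v k - sval (d k) i) < r.
  by case: (d k) => /= dk; exact.
exists (mkseq i N); rewrite -[e](@divfK _ N.+1%:R)// mulr_natr -/r.
apply: (@l1_leW _ _ _ _ (r *+ N)); first by rewrite mulrS lerDr ltW.
apply: (@l1_le_support _ _ _ _ 0%N) => //; first exact: ltW.
  by move=> k Nk; rewrite seqs_subE size_mkseq ltnNge Nk vN// subr0.
move=> k; rewrite seqs_subE size_mkseq; case: ltnP => kN.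
  by rewrite nth_mkseq// rnorm_distC ltW.
by rewrite vN// subr0 rnorm0 ltW.
Qed.

Lemma half_pow_lt (e : R) : 0 < e -> exists r, forall l, (r <= l)%N -> 2^-1 ^+ l < e.
Proof.
move=> e0; exists (Num.bound e^-1) => l rl.
by rewrite exprVn -[e]invrK ltf_pV2 ?posrE ?invr_gt0 ?exprn_gt0// upper_nthrootP.
Qed.

Lemma joint_dense_orbit : bounded_family T -> ball_images_meet T ->
  exists x y, [/\ l1_le x 1, l1_le y 1 &
    forall N v w (e : R), vanish_from v N -> vanish_from w N -> 0 < e ->
      exists n, l1_le (iter n S x - v) e /\ l1_le (iter n S y - w) e].
Proof.
move=> /bounded_familyP[M' M'0 TM'] meet; pose M := Num.max M' 1.
have M1 : 1 <= M by rewrite le_max lexx orbT.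
have TM k (z : X k.+1) : rnorm (T k z) <= M * rnorm z.
  by apply: le_trans (TM' k z) _; rewrite ler_wpM2r ?rnorm_ge0// le_max lexx.
have M0 m : 0 < M ^+ m by rewrite exprn_gt0// (lt_le_trans _ M1).
have [vec [vec_size vec_dense]] := finite_dense_family.
(* The first entry of the decoded list is ignored: it makes every pair of
   targets occur at arbitrarily large indices. *)
pose code l : seq nat * seq nat :=
  odflt ([::], [::]) (unpickle (nth 0%N (CodeSeq.decode l) 1)).
pose v l := vec (code l).1; pose w l := vec (code l).2.
pose err l b : R := (M ^+ b)^-1 * 2^-1 ^+ l.+1.
have step (lb : nat * nat) : exists t : (nat * nat) * (seqs X * seqs X),
    let: (l, b, (n, b', (x, y))) := (lb, t) in
  [/\ (b <= n < b')%N, (forall k, (k < n)%N -> x k = 0 /\ y k = 0),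
    vanish_from x b' /\ vanish_from y b',
    l1_le x (err l b) /\ l1_le y (err l b) &
    l1_le (iter n S x - v l) (2^-1 ^+ l.+1) /\
    l1_le (iter n S y - w l) (2^-1 ^+ l.+1)].
  case: lb => l b; pose N := maxn (size (code l).1) (size (code l).2).
  have vN : vanish_from (v l) N by apply: vanish_fromW (vec_size _); rewrite leq_maxl.
  have wN : vanish_from (w l) N by apply: vanish_fromW (vec_size _); rewrite leq_maxr.
  have e0 : 0 < err l b by rewrite mulr_gt0 ?invr_gt0// exprn_gt0.
  have e_le : err l b <= 2^-1 ^+ l.+1.
    by rewrite ler_piMl ?exprn_ge0// invf_le1 ?exprn_ege1.
  have [n [b' [x [y [bn xyn [xb yb] xye [Sx Sy]]]]]] :=
    shift_approx_pair meet M1 TM b vN wN e0.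
  exists ((n, maxn b' n.+1), (x, y)); split => //; first by lia.
    by split; [apply: vanish_fromW xb|apply: vanish_fromW yb]; rewrite leq_maxl.
  by split; apply: l1_leW e_le _.
have [f fP] := choice step.
pose b := fix b l := if l is l'.+1 then (f (l', b l')).1.2 else 0%N.
pose n l := (f (l, b l)).1.1.
pose xs l := (f (l, b l)).2.1; pose ys l := (f (l, b l)).2.2.
have {}fP l : [/\ (b l <= n l < b l.+1)%N,
    (forall k, (k < n l)%N -> xs l k = 0 /\ ys l k = 0),
    vanish_from (xs l) (b l.+1) /\ vanish_from (ys l) (b l.+1),
    l1_le (xs l) (err l (b l)) /\ l1_le (ys l) (err l (b l)) &
    l1_le (iter (n l) S (xs l) - v l) (2^-1 ^+ l.+1) /\
    l1_le (iter (n l) S (ys l) - w l) (2^-1 ^+ l.+1)].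
  have := fP (l, b l); rewrite /n /xs /ys /=.
  by case: (f (l, b l)) => -[? ?] [? ?].
have bn l : (b l <= n l < b l.+1)%N by have [] := fP l.
have xs_n l k : (k < n l)%N -> xs l k = 0 by have [_ H _ _ _] := fP l => /H[].
have ys_n l k : (k < n l)%N -> ys l k = 0 by have [_ H _ _ _] := fP l => /H[].
have xs_b l : vanish_from (xs l) (b l.+1) by have [_ _ []] := fP l.
have ys_b l : vanish_from (ys l) (b l.+1) by have [_ _ []] := fP l.
have xs_le l : l1_le (xs l) (err l (b l)) by have [_ _ _ []] := fP l.
have ys_le l : l1_le (ys l) (err l (b l)) by have [_ _ _ []] := fP l.
have xs_v l : l1_le (iter (n l) S (xs l) - v l) (2^-1 ^+ l.+1).
  by have [_ _ _ _ []] := fP l.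
have ys_w l : l1_le (iter (n l) S (ys l) - w l) (2^-1 ^+ l.+1).
  by have [_ _ _ _ []] := fP l.
exists (diag_sum xs), (diag_sum ys); split.
- exact: (l1_le_diag_sum M1 bn).
- exact: (l1_le_diag_sum M1 bn).
move=> N v' w' e v'N w'N e0.
have e20 : 0 < e / 2 by rewrite divr_gt0.
have [c cv'] := vec_dense _ _ _ v'N e20; have [c' cw'] := vec_dense _ _ _ w'N e20.
have [r re] := half_pow_lt e20.
pose l := CodeSeq.code [:: r; pickle (c, c')].
have codel : code l = (c, c') by rewrite /code CodeSeq.codeK/= pickleK.
have rl : (r < l)%N by have /andP[] := CodeSeq.ltn_code [:: r; pickle (c, c')].
have le2 := ltW (re l (ltnW rl)).
exists (n l); split.
  have -> : iter (n l) S (diag_sum xs) - v' =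
      (iter (n l) S (diag_sum xs) - v l) + (v l - v') by rewrite addrA subrK.
  rewrite [e]splitr; apply: l1_leD; last by rewrite /v codel.
  by apply: l1_leW le2 _; exact: (orbit_diag_sum M1 TM bn).
have -> : iter (n l) S (diag_sum ys) - w' =
    (iter (n l) S (diag_sum ys) - w l) + (w l - w') by rewrite addrA subrK.
rewrite [e]splitr; apply: l1_leD; last by rewrite /w codel.
by apply: l1_leW le2 _; exact: (orbit_diag_sum M1 TM bn).
Qed.
End joint_orbit.

(** * Hypercyclicity on an abstract sequence space *)

Lemma iter_pair (A : Type) (f : A -> A) n (z : A * A) :
  iter n (fun z => (f z.1, f z.2)) z = (iter n f z.1, iter n f z.2).
Proof. by elim: n => [|n IHn]; [case: z|rewrite !iterS IHn]. Qed.

Lemma weakly_mixing_hypercyclic (Y : topologicalType) (S : Y -> Y) :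
  weakly_mixing S -> hypercyclic S.
Proof.
move=> [z dz]; exists z.1 => O [y Oy] oO.
have [] := dz (fst @^-1` O).
- by exists (y, y).
- by apply: open_comp => // u _; exact: cvg_fst.
move=> w [/= Ow [n _ nw]]; rewrite -nw iter_pair/= in Ow.
by exists (iter n S z.1); split => //; exists n.
Qed.

Lemma open_set1_eq (R : realType) (s : scalars)
    (V : normedModType (scalar_field R s)) (z w : V) : open [set z] -> w = z.
Proof.
move=> oz; have [e e0 ze] := open_rnormP oz (erefl z).
apply/eqP; rewrite -subr_eq0; apply: contrapT => /negP wz.
have r0 : 0 < rnorm (w - z).
  rewrite lt_neqAle rnorm_ge0 andbT eq_sym.
  by apply: contra wz => /eqP/rnorm_eq0/eqP.
pose t := e / 2 / rnorm (w - z).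
have t0 : 0 <= t by rewrite !divr_ge0// ltW.
pose u := of_real s t *: (w - z).
have ru : rnorm u = e / 2.
  by rewrite rnormZ real_part_norm_of_real// divfK// gt_eqF.
have : z + u = z by apply: ze; rewrite opprD addrA subrr sub0r rnormN ru; lra.
move=> /(congr1 (fun v => v - z)); rewrite addrAC subrr add0r => u0.
by move: ru; rewrite u0 rnorm0; lra.
Qed.

Lemma dense_orbit_late (R : realType) (s : scalars)
    (V : normedModType (scalar_field R s)) (S : V -> V) (y : V) :
  dense (range (fun n => iter n S y)) ->
  forall L O, open O -> O !=set0 -> exists2 n, (L <= n)%N & O (iter n S y).
Proof.
move=> dy; elim=> [|L IHL] O oO O0.
  by have [z [Oz [n _ yn]]] := dy O O0 oO; exists n; rewrite // yn.
have [n Ln On] := IHL O oO O0.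
have [L'n|nL] := ltnP L n; first by exists n.
have nE : n = L by apply/eqP; rewrite eqn_leq nL.
rewrite {}nE {n nL Ln} in On.
have [[z Oz]|noO] := pselect ((O `\ iter L S y) !=set0).
  have [||n Ln [On' yn]] := IHL (O `\ iter L S y).
  - by rewrite setDE; apply: openI => //; apply: closed_openC;
    exact: accessible_closed_set1 (hausdorff_accessible (@norm_hausdorff _ V)) _.
  - by exists z.
  exists n => //; rewrite ltn_neqAle Ln andbT.
  by apply/eqP => nL; apply: yn; rewrite nL.
have O1 : O = [set iter L S y].
  apply/seteqP; split=> [z Oz|_ -> //].
  by apply: contrapT => zy; apply: noO; exists z.
exists L.+1 => //; rewrite O1; apply: open_set1_eq; by rewrite -O1.
Qed.

Section shift_on_sequence_space.
Variables (R : realType) (s : scalars).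
Local Notation K := (scalar_field R s).
Variable X : nat -> completeNormedModType K.
Variable T : forall k, {linear X k.+1 -> X k}.
Hypothesis hT : bounded_family T.
Variables (Y : normedModType K) (val : Y -> seqs X) (S : Y -> Y).
Hypothesis valB : forall a b, val (a - b) = val a - val b.
Hypothesis val_rnorm : forall a k, rnorm (val a k) <= rnorm a.
Hypothesis val_l1 : forall x c, l1_le x c -> exists a, val a = x.
Hypothesis rnorm_l1 : forall a c, l1_le (val a) c -> rnorm a <= c.
Hypothesis val_dense : forall a (e : R), 0 < e ->
  exists N b, vanish_from (val b) N /\ rnorm (a - b) < e.
Hypothesis valS : forall a, val (S a) = seq_shift T (val a).

Lemma val_iter n a : val (iter n S a) = iter n (seq_shift T) (val a).
Proof. by elim: n => // n IHn; rewrite !iterS valS IHn. Qed.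

Lemma val_vanish x N : vanish_from x N -> exists a, val a = x.
Proof. by move=> /l1_le_vanish/val_l1. Qed.

Lemma val_near0 a (e : R) : 0 < e ->
  exists N, forall k, (N <= k)%N -> rnorm (val a k) < e.
Proof.
move=> /(val_dense a)[N [b [bN ab]]]; exists N => k Nk.
apply: le_lt_trans ab; apply: le_trans (val_rnorm _ k).
by rewrite valB seqs_subE bN// subr0.
Qed.

Lemma rnormB_le a b c (d e : R) :
  rnorm (a - b) < d -> l1_le (val b - val c) e -> rnorm (a - c) < d + e.
Proof.
move=> ab; rewrite -valB => /rnorm_l1 bc; rewrite -(subrK b a) -addrA.
by apply: le_lt_trans (rnormD _ _) _; exact: ltr_leD.
Qed.

Lemma hypercyclic_separable : hypercyclic S -> forall k, separable_space (X k).
Proof.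
move=> [y dy] k; exists (range (fun n => val (iter n S y) k)).
  exact: (sub_countable (card_image_le _ _)).
move=> O [z Oz] oO; have [e e0 ze] := open_rnormP oO Oz.
pose x : seqs X := dfwith (0 : seqs X) k z.
have xk : x k = z by rewrite /x dfwithin.
have [a ax] : exists a, val a = x.
  apply: (@val_vanish _ k.+1) => j kj; rewrite /x dfwithout//.
  by rewrite neq_ltn kj.
have [] := dy (ball a (of_real s e)).
- by exists a; apply/ball_rnorm; rewrite subrr rnorm0.
- exact: ball_open.
move=> w [aw [n _ nw]]; move: aw; rewrite -nw => /ball_rnorm an.
exists (val (iter n S y) k).
split; last by exists n.
apply: ze; rewrite -xk -ax -seqs_subE -valB.
exact: le_lt_trans (val_rnorm _ k) an.
Qed.

Lemma hypercyclic_meet : hypercyclic S -> ball_images_meet T.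
Proof.
move=> [y dy] N U _ oU.
have one : (1 : K) = of_real s 1 by rewrite of_real1.
have [k|x xU] := @seqs_choice _ _ X (fun k z =>
    ((N <= k)%N -> z = 0) /\ forall kN : (k < N)%N, U (Ordinal kN) z).
  have [kN|kN] := pselect (k < N)%N; last by exists 0; split => // kN'; case: kN.
  have [_ [z Uz]] := oU (Ordinal kN); exists z; split => [|kN']; first by lia.
  by rewrite (bool_irrelevance kN' kN).
have [a ax] : exists a, val a = x by apply: (@val_vanish _ N) => k; have [] := xU k.
have /choice[r rP] (j : 'I_N) : exists r : R, 0 < r /\
    forall z, rnorm (x j - z) < r -> U j z.
  case: j => j jN; have [oUj _] := oU (Ordinal jN); have [_ /(_ jN) xj] := xU j.
  by have [e e0 eU] := open_rnormP oUj xj; exists e.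
pose e : R := \big[Order.min/1]_(j < N) r j.
have e0 : 0 < e by apply: lt_bigmin => [|j _]; [exact: ltr01|have [] := rP j].
have [L yL] := val_near0 y ltr01.
have [] := dense_orbit_late dy L.+1 (O := ball a (of_real s e)).
- exact: ball_open.
- by exists a; apply/ball_rnorm; rewrite subrr rnorm0.
move=> n Ln /ball_rnorm an; exists n; first by lia.
move=> j; exists (val (iter n S y) j); split.
  exists (val y (n + j)%N).
    by rewrite one; apply/ball_rnorm; rewrite sub0r rnormN yL//; lia.
  by rewrite val_iter iter_seq_shiftE.
have [_] := rP j; apply.
rewrite -ax -seqs_subE -valB; apply: le_lt_trans (val_rnorm _ j) _.
by apply: lt_le_trans an _; exact: bigmin_le_cond.
Qed.

Lemma meet_weakly_mixing : (forall k, separable_space (X k)) ->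
  ball_images_meet T -> weakly_mixing S.
Proof.
move=> X_sep meet; have [x [y [x1 y1 xy]]] := joint_dense_orbit X_sep hT meet.
have [a ax] := val_l1 x1; have [b yb] := val_l1 y1.
exists (a, b) => O [[u v] Ouv] oO.
have [[A B] [/= uA vB] ABO] : nbhs (u, v) O by exact: open_nbhs_nbhs.
have /nbhs_rnormP[e e0 eA] := uA; have /nbhs_rnormP[d d0 dB] := vB.
pose c := Num.min e d / 2.
have c0 : 0 < c by rewrite divr_gt0// lt_min e0.
have cc : c + c = Num.min e d by rewrite -splitr.
have [N [u' [u'N uu']]] := val_dense u c0.
have [N' [v' [v'N vv']]] := val_dense v c0.
have [||n [xn yn]] := xy (maxn N N') (val u') (val v') c _ _ c0.
- by apply: vanish_fromW u'N; rewrite leq_maxl.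
- by apply: vanish_fromW v'N; rewrite leq_maxr.
rewrite -ax -val_iter in xn; rewrite -yb -val_iter in yn.
exists (iter n S a, iter n S b); split; last by exists n; rewrite // iter_pair.
apply: ABO; split => /=.
  apply: eA; rewrite (@lt_le_trans _ _ (c + c))//; last by rewrite cc ge_min lexx.
  by apply: rnormB_le uu' _; rewrite -opprB; exact: l1_leN.
apply: dB; rewrite (@lt_le_trans _ _ (c + c))//; last by rewrite cc ge_min lexx orbT.
by apply: rnormB_le vv' _; rewrite -opprB; exact: l1_leN.
Qed.

Lemma shift_equivalences :
  [/\ hypercyclic S <-> weakly_mixing S, hypercyclic S -> ball_images_meet T
    & (forall k, separable_space (X k)) -> ball_images_meet T -> hypercyclic S].
Proof.
split; [split| |].
- move=> hS; apply: meet_weakly_mixing; first exact: hypercyclic_separable.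
  exact: hypercyclic_meet.
- exact: weakly_mixing_hypercyclic.
- exact: hypercyclic_meet.
- by move=> X_sep meet; apply: weakly_mixing_hypercyclic; exact: meet_weakly_mixing.
Qed.

End shift_on_sequence_space.

(** * The spaces l^p and c_0 *)

Section truncation.
Variables (R : realType) (s : scalars).
Variable X : nat -> completeNormedModType (scalar_field R s).

Definition truncate (N : nat) (x : seqs X) : seqs X :=
  fun k => if (k < N)%N then x k else 0.

Lemma truncate_vanish N x : vanish_from (truncate N x) N.
Proof. by move=> k; rewrite leqNgt /truncate => /negbTE ->. Qed.

Lemma sub_truncateE N x k :
  (x - truncate N x) k = if (k < N)%N then 0 else x k.
Proof. by rewrite seqs_subE /truncate; case: ifP; rewrite (subrr, subr0). Qed.

End truncation.

Lemma powR_le_inv (R : realType) (p x y : R) : 0 < p -> 0 <= x -> 0 <= y ->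
  x `^ p <= y `^ p -> x <= y.
Proof.
move=> p0 x0 y0; apply: contraTT; rewrite -!ltNge => yx.
by apply: gt0_ltr_powR; rewrite ?nnegrE.
Qed.

Section lp_instance.
Variables (R : realType) (s : scalars).
Variable X : nat -> completeNormedModType (scalar_field R s).
Variables (p : R) (p1 : 1 <= p).
Local Notation Y := (lp_space X p1).
Implicit Types (a : Y) (x : seqs X).

Let p0 : 0 < p. Proof. exact: lt_le_trans p1. Qed.

Lemma lp_rnormE a : rnorm a = lp_norm p a.
Proof. exact: of_realK. Qed.

Lemma lp_norm_ge0 x : 0 <= lp_norm p x.
Proof. exact: powR_ge0. Qed.

Lemma le_lp_norm a k : rnorm (lp_val a k) <= lp_norm p a.
Proof.
apply: (powR_le_inv p0); rewrite ?rnorm_ge0 ?lp_norm_ge0//.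
rewrite -lee_fin -(lp_sumE p1 (lp_valP a)).
apply: le_trans (nneseries_lim_ge k.+1 _); last first.
  by move=> n _ _; rewrite lee_fin powR_ge0.
by rewrite big_nat_recr//= leeDr// sume_ge0// => n _; rewrite lee_fin powR_ge0.
Qed.

Lemma l1_le_lp_sum x (c : R) : l1_le x c -> (lp_sum p x <= (c `^ p)%:E)%E.
Proof.
move=> xc; have c0 : 0 <= c by exact: le_trans (rnorm_ge0 _) (l1_le_rnorm 0 xc).
apply: lime_le.
  by apply: is_cvg_nneseries => k _ _; rewrite lee_fin powR_ge0.
apply: nearW => n; rewrite sumEFin lee_fin -mulr_powRB1//.
apply: le_trans (_ : (\sum_(0 <= k < n) rnorm (x k)) * c `^ (p - 1) <= _); last first.
  by rewrite ler_wpM2r ?powR_ge0.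
rewrite mulr_suml ler_sum// => k _; rewrite -mulr_powRB1 ?rnorm_ge0//.
rewrite ler_wpM2l ?rnorm_ge0// ge0_ler_powR ?nnegrE ?rnorm_ge0 ?subr_ge0//.
exact: l1_le_rnorm.
Qed.

Lemma l1_le_lp_pred x (c : R) : l1_le x c -> x \in lp_pred p.
Proof. by move=> /l1_le_lp_sum xc; rewrite inE/= (le_lt_trans xc)// ltry. Qed.

Lemma lp_norm_le x (c : R) : 0 <= c -> (lp_sum p x <= (c `^ p)%:E)%E ->
  lp_norm p x <= c.
Proof.
move=> c0 xc; have c_fin : (lp_sum p x < +oo)%E by rewrite (le_lt_trans xc)// ltry.
apply: (powR_le_inv p0) => //; first exact: lp_norm_ge0.
by rewrite -lee_fin -(lp_sumE p1)// inE.
Qed.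

Lemma lp_truncate_dense a (e : R) : 0 < e ->
  exists N b, vanish_from (lp_val b) N /\ rnorm (a - b) < e.
Proof.
move=> e0; have e20 : 0 < e / 2 by rewrite divr_gt0.
have term_ge0 k : (0 <= (rnorm (lp_val a k) `^ p)%:E)%E by rewrite lee_fin powR_ge0.
have := lp_valP a; rewrite inE/= => /nneseries_tail_cvg => /(_ (fun k _ => term_ge0 k)).
move=> /(_ [set t | (t < ((e / 2) `^ p)%:E)%E]) [|N _ tailN].
  apply: open_nbhs_nbhs; split; first exact: open_ereal_lt_ereal.
  by rewrite /= lte_fin powR_gt0.
have bl : truncate N a \in lp_pred p.
  exact: l1_le_lp_pred (l1_le_vanish (@truncate_vanish _ _ _ N a)).
exists N, (Lp p1 bl); split; first exact: truncate_vanish.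
apply: (@le_lt_trans _ _ (e / 2)); last lra.
rewrite lp_rnormE; apply: lp_norm_le; first exact: ltW.
apply: le_trans (ltW (tailN N (leqnn N))).
rewrite /= eseries_cond eseries_mkcond/= /lp_sum le_eqVlt; apply/orP; left.
apply/eqP/eq_eseriesr => k _; rewrite sub_truncateE ltnNge.
by case: (N <= k)%N; rewrite //= rnorm0 powR0// gt_eqF.
Qed.

Lemma lp_equivalences (T : forall k, {linear X k.+1 -> X k})
    (hT : bounded_family T) (S := lp_shift p1 hT) :
  [/\ hypercyclic S <-> weakly_mixing S, hypercyclic S -> ball_images_meet T
    & (forall k, separable_space (X k)) -> ball_images_meet T -> hypercyclic S].
Proof.
apply: (@shift_equivalences _ _ _ _ hT _ (@lp_val _ _ _ _ p1)) => //.
- by move=> a k; rewrite lp_rnormE le_lp_norm.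
- by move=> x c xc; exists (Lp p1 (l1_le_lp_pred xc)).
- move=> a c ac; rewrite lp_rnormE.
  have c0 : 0 <= c by apply: le_trans (rnorm_ge0 _) (l1_le_rnorm 0 ac).
  exact: lp_norm_le (l1_le_lp_sum ac).
- exact: lp_truncate_dense.
Qed.

End lp_instance.

Section c0_instance.
Variables (R : realType) (s : scalars).
Variable X : nat -> completeNormedModType (scalar_field R s).
Local Notation Y := (c0_space X).
Implicit Types (a : Y) (x : seqs X).

Lemma c0_rnormE a : rnorm a = c0_norm a.
Proof. exact: of_realK. Qed.

Lemma l1_le_c0_pred x (c : R) : l1_le x c -> x \in @c0_pred _ _ X.
Proof.
move=> xc; rewrite inE/=; apply: cvg_series_cvg_0.
apply: nondecreasing_is_cvgn.
  apply: nondecreasing_series => k _ _; exact: rnorm_ge0.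
by exists c => _ [n _ <-]; exact: xc.
Qed.

Lemma c0_truncate_dense a (e : R) : 0 < e ->
  exists N b, vanish_from (c0_val b) N /\ rnorm (a - b) < e.
Proof.
move=> e0; have e20 : 0 < e / 2 by rewrite divr_gt0.
have := c0_valP a; rewrite inE/= => /cvgr0Pnorm_lt/(_ _ e20)[N _ aN].
have bc : truncate N a \in @c0_pred _ _ X.
  exact: l1_le_c0_pred (l1_le_vanish (@truncate_vanish _ _ _ N a)).
exists N, (C0 bc); split; first exact: truncate_vanish.
apply: (@le_lt_trans _ _ (e / 2)); last lra.
rewrite c0_rnormE; apply: c0_norm_le => k.
rewrite [X in rnorm X](sub_truncateE N (c0_val a) k); case: ltnP => Nk.
  by rewrite rnorm0 ltW.
by have := aN k Nk; rewrite /= ger0_norm ?rnorm_ge0// => /ltW.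
Qed.

Lemma c0_equivalences (T : forall k, {linear X k.+1 -> X k})
    (hT : bounded_family T) (S := c0_shift hT) :
  [/\ hypercyclic S <-> weakly_mixing S, hypercyclic S -> ball_images_meet T
    & (forall k, separable_space (X k)) -> ball_images_meet T -> hypercyclic S].
Proof.
apply: (@shift_equivalences _ _ _ _ hT _ (@c0_val _ _ _)) => //.
- by move=> a k; rewrite c0_rnormE le_c0_norm// c0_valP.
- by move=> x c xc; exists (C0 (l1_le_c0_pred xc)).
- by move=> a c ac; rewrite c0_rnormE; apply: c0_norm_le => k; exact: l1_le_rnorm.
- exact: c0_truncate_dense.
Qed.

End c0_instance.

Theorem proposition2p2 (R : realType) (s : scalars)
    (X : nat -> completeNormedModType (scalar_field R s))
    (T : forall k : nat, {linear X k.+1 -> X k}) (hT : bounded_family T) :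
  (forall (p : R) (p1 : 1 <= p),
     [/\ hypercyclic (lp_shift p1 hT) <-> weakly_mixing (lp_shift p1 hT),
         hypercyclic (lp_shift p1 hT) -> ball_images_meet T
       & (forall k : nat, separable_space (X k)) ->
           ball_images_meet T -> hypercyclic (lp_shift p1 hT)]) /\
  [/\ hypercyclic (c0_shift hT) <-> weakly_mixing (c0_shift hT),
      hypercyclic (c0_shift hT) -> ball_images_meet T
    & (forall k : nat, separable_space (X k)) ->
        ball_images_meet T -> hypercyclic (c0_shift hT)].
Proof.
split; [move=> p p1; exact: lp_equivalences|exact: c0_equivalences].
Qed.
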